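(* Let $K\subset[1,\infty)$ be bounded with $1\in K$, and let $d\ge1$. Define $$\Delta_d^{\mathrm{LP}}(K)=\mathrm{vol}\left(\tfrac12B_d\right)\inf\frac{F(0)}{\widehat F(0)},$$ where the infimum is over all nonzero $F\in L^1(\mathbb{R}^d)\cap C(\mathbb{R}^d)$ such that $F(x)\le0$ whenever $|x|\in K\cup(\sup K,\infty)$ and $\widehat F(x)\ge0$ for all $x$. Then $\Delta_d(K)\le\Delta_d^{\mathrm{LP}}(K)$.
   Context: $B_d$ is the closed unit ball in $\mathbb{R}^d$, $Q_d=[-\tfrac12,\tfrac12]^d$. A sphere packing is $P=X+\tfrac12B_d$ with $|x-y|\in\{0\}\cup[1,\infty)$ for $x,y\in X$; $\mathrm{dens}(P)=\limsup_{t\to\infty}\mathrm{vol}(P\cap tQ_d)/\mathrm{vol}(tQ_d)$. $\mathcal P_d(K)$ is the set of such packings with $|x-y|\in\{0\}\cup K\cup(\sup K,\infty)$ for all $x,y\in X$ ($K$-admissible packings), and $\Delta_d(K)=\sup_{P\in\mathcal P_d(K)}\mathrm{dens}(P)$. Fourier transform: $\widehat F(\xi)=\int_{\mathbb{R}^d}F(x)e^{-2\pi i x\cdot\xi}\,dx$. *)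

(* Defs.v *)
From HB Require Import structures.
From mathcomp Require Import all_boot all_order all_algebra.
From mathcomp Require Import all_classical all_reals all_analysis.
From mathcomp Require Import complex.

Set Implicit Arguments.
Unset Strict Implicit.
Unset Printing Implicit Defensive.

Import Order.TTheory GRing.Theory Num.Theory.
Import numFieldNormedType.Exports.

Local Open Scope classical_set_scope.
Local Open Scope ring_scope.

(* Points of R^d are row vectors 'rV[R]_d, with the library's topology (the
   product topology).  The library's norm `|x| on 'rV[R]_d is the max norm, so
   the Euclidean norm is a separate definition. *)
Section Euclidean.
Context {R : realType} {d : nat}.
Implicit Types x y : 'rV[R]_d.

Definition dot x y : R := \sum_(i < d) x 0 i * y 0 i.

Definition enorm x : R := Num.sqrt (dot x x).

End Euclidean.

(* The sigma-algebra on R^d generated by the coordinates, i.e. the d-fold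
   product of the Borel sigma-algebra of R; it is the Borel sigma-algebra. *)
Fact rV_display : measure_display.
Proof. exact: default_measure_display. Qed.

Section rV_measurable.
Context {R : realType} (d : nat).

Definition rV_coord (i : 'I_d) (x : 'rV[R]_d) : measurableTypeR R := x 0 i.

Let rV_measurable0 : g_sigma_preimage rV_coord set0.
Proof. exact: sigma_algebra0. Qed.

Let rV_measurableC A :
  g_sigma_preimage rV_coord A -> g_sigma_preimage rV_coord (~` A).
Proof. exact: sigma_algebraC. Qed.

Let rV_measurable_bigcup (F : (set 'rV[R]_d)^nat) :
  (forall i, g_sigma_preimage rV_coord (F i)) ->
  g_sigma_preimage rV_coord (\bigcup_i F i).
Proof. exact: sigma_algebra_bigcup. Qed.

HB.instance Definition _ := @isMeasurable.Build rV_display 'rV[R]_d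
  (g_sigma_preimage rV_coord) rV_measurable0 rV_measurableC
  rV_measurable_bigcup.

End rV_measurable.

Section Lebesgue_measure.
Context {R : realType}.

Definition rV_cons d (p : measurableTypeR R * 'rV[R]_d) : 'rV[R]_d.+1 :=
  row_mx (p.1 : R)%:M p.2 : 'rV[R]_(1 + d).

Lemma rV_cons0 d p : @rV_cons d p 0 ord0 = p.1.
Proof.
have -> : ord0 = lshift d (ord0 : 'I_1) by exact: val_inj.
by rewrite [LHS]row_mxEl mxE mulr1n.
Qed.

Lemma rV_consS d p j : @rV_cons d p 0 (lift ord0 j) = p.2 0 j.
Proof.
have -> : lift ord0 j = rshift 1 j by exact: val_inj.
exact: row_mxEr.
Qed.

Lemma measurable_rV_cons d : measurable_fun [set: _] (@rV_cons d).
Proof.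
apply: (@measurability _ _ _ _ _ _
  (\big[setU/set0]_(i < d.+1)
     preimage_set_system setT (@rV_coord R d.+1 i) measurable)) => //.
move=> A [C]; rewrite -bigcup_seq => -[i _ /= [B mB <-]] <-{A C}.
rewrite !setTI; case: (unliftP ord0 i) => [j ->|->].
  rewrite [X in measurable X](_ : _ = setT `*` (rV_coord j @^-1` B)).
    apply: measurableX => //; apply: sub_sigma_algebra.
    rewrite -bigcup_seq; exists j; first by rewrite /= mem_index_enum.
    by exists B => //; rewrite setTI.
  by apply/seteqP; split=> p; rewrite /rV_coord /= rV_consS //; case.
rewrite [X in measurable X](_ : _ = B `*` setT); first exact: measurableX.
by apply/seteqP; split=> p; rewrite /rV_coord /= rV_cons0 //; case.
Qed.

Section vol_succ.
Context (d : nat) (mu : {measure set 'rV[R]_d -> \bar R}).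

Definition vol_succ : set 'rV[R]_d.+1 -> \bar R :=
  pushforward (lebesgue_measure \x^ mu)%E (@rV_cons d).

Let vol_succ0 : vol_succ set0 = 0%E.
Proof. have mf := @measurable_rV_cons d; exact: measure0. Qed.

Let vol_succ_ge0 A : (0 <= vol_succ A)%E.
Proof. have mf := @measurable_rV_cons d; exact: measure_ge0. Qed.

Let vol_succ_sigma_additive : semi_sigma_additive vol_succ.
Proof. have mf := @measurable_rV_cons d; exact: measure_semi_sigma_additive. Qed.

HB.instance Definition _ := isMeasure.Build _ _ _ vol_succ
  vol_succ0 vol_succ_ge0 vol_succ_sigma_additive.

End vol_succ.

(* Lebesgue measure on R^d, as the d-fold product of [lebesgue_measure]
   transported along R * R^d = R^(d+1). *)
Fixpoint vol (d : nat) : {measure set 'rV[R]_d -> \bar R} :=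
  match d with
  | 0 => dirac (0 : 'rV[R]_0)
  | d'.+1 => vol_succ (vol d')
  end.

End Lebesgue_measure.
Arguments vol {R} d.

Section Fourier_transform.
Context {R : realType} {d : nat}.
Local Open Scope complex_scope.

Definition cintegral (f : 'rV[R]_d -> R[i]) : R[i] :=
  (\int[vol d]_x complex.Re (f x)) +i* (\int[vol d]_x complex.Im (f x)).

Definition cis (t : R) : R[i] := cos t +i* sin t.

Definition fourier (F : 'rV[R]_d -> R) (xi : 'rV[R]_d) : R[i] :=
  cintegral (fun x => (F x)%:C * cis (- (2 * pi * dot x xi))).

End Fourier_transform.

Section Packings.
Context {R : realType}.
Implicit Types (d : nat) (K : set R) (t : R).

Definition unit_ball d : set 'rV[R]_d := [set x | enorm x <= 1].

Definition cube d : set 'rV[R]_d :=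
  [set x | forall i, - 2^-1 <= x 0 i <= 2^-1].

Definition dilate d t (A : set 'rV[R]_d) : set 'rV[R]_d :=
  [set t *: x | x in A].

Definition balls d (X : set 'rV[R]_d) : set 'rV[R]_d :=
  [set x + y | x in X & y in dilate 2^-1 (@unit_ball d)].

Definition packing_centers d (X : set 'rV[R]_d) :=
  forall x y, X x -> X y -> ([set 0] `|` `[1, +oo[) (enorm (x - y)).

Definition admissible_centers d K (X : set 'rV[R]_d) :=
  forall x y, X x -> X y ->
    ([set 0] `|` K `|` `]sup K, +oo[) (enorm (x - y)).

Definition admissible_packings d K : set (set 'rV[R]_d) :=
  [set balls X | X in [set X | packing_centers X /\ admissible_centers K X]].

Definition density d (P : set 'rV[R]_d) : \bar R :=
  limf_esup (fun t : R =>
    vol d (P `&` dilate t (@cube d)) / vol d (dilate t (@cube d)))%E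
    (pinfty_nbhs R).

Definition max_density d K : \bar R :=
  ereal_sup [set density P | P in @admissible_packings d K].

End Packings.

Section LP_bound.
Context {R : realType}.
Local Open Scope complex_scope.

(* The order on R[i] is the partial one: [0 <= z] says that z is real and
   nonnegative. *)
Definition LP_feasible d (K : set R) (F : 'rV[R]_d -> R) :=
  [/\ (exists x, F x != 0),
      (vol d).-integrable setT (EFin \o F),
      continuous F,
      (forall x, (K `|` `]sup K, +oo[) (enorm x) -> F x <= 0) &
      (forall xi, 0 <= fourier F xi)].

(* The quotient is taken in \bar R, where the inverse of 0 is +oo, so that
   an F with zero integral does not contribute to the infimum. *)
Definition LP_ratio d (F : 'rV[R]_d -> R) : \bar R :=
  ((F 0)%:E / (complex.Re (fourier F 0))%:E)%E.

Definition LP_bound d (K : set R) : \bar R :=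
  (vol d (dilate 2^-1 (@unit_ball R d)) *
   ereal_inf [set LP_ratio F | F in @LP_feasible d K])%E.

End LP_bound.

(* Main.v *)
(** Neither Poisson summation nor Fourier inversion is used. Multiplication by
    cos(eta . x) preserves nonnegativity of the (cosine) transform, hence so do
    exp(lam (cos(eta . x) - 1)) and, letting lam = m^2 and eta / m with m to
    infinity, all Gaussians. Thus f integrates to a nonnegative number against
    every Gaussian centered at 0, and f(0) >= 0 if f is continuous. Applied to
    sums of translates of F, this shows that F is a positive definite function.
    Now test positive definiteness with the measure sum_{x in A} delta_x - c dy
    on a cube C slightly larger than the cube of side t that contains the finite
    set A of centers: as F <= 0 at the differences of distinct centers, up to
    boundary terms
      0 <= |A| F(0) - 2 c |A| Fhat(0) + c^2 t^d Fhat(0),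
    and c = |A| / t^d gives |A| / t^d <= F(0) / Fhat(0) asymptotically. *)
Require Import Defs.
From mathcomp Require Import all_boot all_order all_algebra.
From mathcomp Require Import all_classical all_reals all_analysis measurable_realfun.
From mathcomp Require Import complex.
From mathcomp Require Import ring lra.

Set Implicit Arguments.
Unset Strict Implicit.
Unset Printing Implicit Defensive.

Import Order.TTheory GRing.Theory Num.Theory.
Import numFieldNormedType.Exports.

Local Open Scope classical_set_scope.
Local Open Scope ring_scope.

(** * Lebesgue measure of boxes *)

Section volume.
Context {R : realType}.

Definition box d (B : 'I_d -> set R) : set 'rV[R]_d :=
  [set x | forall i, B i (x 0 i)].

Lemma measurable_coord d (i : 'I_d) :
  measurable_fun setT (fun x : 'rV[R]_d => x 0 i : measurableTypeR R).
Proof.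
move=> _ A mA; rewrite setTI; apply: sub_sigma_algebra.
by rewrite -bigcup_seq; exists i => /=; [rewrite mem_index_enum | exists A; rewrite ?setTI].
Qed.

Lemma boxE d (B : 'I_d -> set R) :
  box B = \big[setI/setT]_(i < d) ((fun x : 'rV[R]_d => x 0 i) @^-1` B i).
Proof.
rewrite -bigcap_seq; apply/seteqP; split => x /= Bx i /=; first by move=> _; exact: Bx.
by apply: Bx; rewrite /= mem_index_enum.
Qed.

Lemma measurable_box d (B : 'I_d -> set R) :
  (forall i, measurable (B i : set (measurableTypeR R))) -> measurable (box B).
Proof.
move=> mB; rewrite boxE; apply: bigsetI_measurable => i _.
by rewrite -[X in measurable X]setTI; exact: measurable_coord.
Qed.

Lemma vol_box d (B : 'I_d -> set R) :
  (forall i, measurable (B i : set (measurableTypeR R))) ->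
  vol d (box B) = (\prod_(i < d) lebesgue_measure (B i))%E.
Proof.
elim: d B => [|d IH] B mB.
  by rewrite big_ord0 /= diracE mem_set //= => -[].
rewrite big_ord_recl -(IH (fun j => B (lift ord0 j))) //.
rewrite -product_measure2E //; last exact: measurable_box.
rewrite /= /vol_succ /pushforward; congr (_ _).
apply/seteqP; split => -[a x] /=.
  move=> Bx; split; first by have := Bx ord0; rewrite rV_cons0.
  by move=> j; have := Bx (lift ord0 j); rewrite rV_consS.
by move=> [Ba Bx] i; case: (unliftP ord0 i) => [j ->|->]; rewrite ?rV_consS ?rV_cons0.
Qed.

(** Boxes are stable under intersection, as the uniqueness theorem for measures asks of a generating
    family. *)
Lemma measurable_rV_boxes d : @measurable _ 'rV[R]_d =
  <<s [set box B | B in [set B : 'I_d -> set (measurableTypeR R) |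
                         forall i, measurable (B i)]] >>.
Proof.
apply/seteqP; split.
  apply: smallest_sub; first exact: smallest_sigma_algebra.
  move=> A; rewrite -bigcup_seq => -[i _ /= [B mB <-]]; rewrite setTI.
  apply: sub_sigma_algebra.
  exists (fun j => if j == i then B else setT).
    by move=> j /=; case: ifP.
  apply/seteqP; split => x /=; first by move/(_ i); rewrite eqxx.
  by move=> Bx j; case: ifP => // /eqP ->.
apply: smallest_sub; first exact: sigma_algebra_measurable.
by move=> _ [B mB <-]; exact: measurable_box.
Qed.

Definition ccube d (r : R) : set 'rV[R]_d := box (fun=> `[- r, r]%classic).

Lemma measurable_ccube d r : measurable (@ccube d r).
Proof. exact: measurable_box. Qed.

Lemma vol_ccube d r : 0 <= r -> vol d (@ccube d r) = ((2 * r) ^+ d)%:E.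
Proof.
move=> r0; rewrite vol_box //.
rewrite (eq_bigr (fun=> (2 * r)%:E)); last first.
  move=> i _; rewrite lebesgue_measure_itv /= lte_fin; case: ltP => [_|rr].
    by rewrite -EFinD; congr EFin; lra.
  by congr EFin; lra.
by rewrite prodEFin prodr_const card_ord.
Qed.

(** The boxes form an intersection-stable generating family, and the cubes of half-side [n], which
    are boxes of finite volume, exhaust the space. *)
Lemma vol_unique d (m : {measure set 'rV[R]_d -> \bar R}) :
  (forall B : 'I_d -> set (measurableTypeR R),
     (forall i, measurable (B i)) -> m (box B) = vol d (box B)) ->
  forall A, measurable A -> vol d A = m A.
Proof.
move=> mE; apply: (measure_unique _ (fun n => @ccube d n%:R) (@measurable_rV_boxes d)).
- move=> _ _ [B mB <-] [C mC <-]; exists (fun i => B i `&` C i).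
    by move=> i; exact: measurableI.
  apply/seteqP; split => x /=; first by move=> BCx; split=> i; have [] := BCx i.
  by move=> [Bx Cx] i; split.
- by move=> n; exists (fun=> `[- n%:R, n%:R]%classic).
- apply/seteqP; split => // x _.
  pose M : R := \sum_(i < d) `|x 0 i|.
  exists (Num.truncn M).+1 => //= i; rewrite /= in_itv /= -ler_norml.
  apply: (@le_trans _ _ M); last by rewrite ltW // truncnS_gt.
  by rewrite /M (bigD1 i) //= lerDl sumr_ge0.
- by move=> _ [B mB <-]; rewrite mE.
- by move=> n; rewrite vol_ccube // ltry.
Qed.

Lemma measurable_rV d d' (T : measurableType d') (f : T -> 'rV[R]_d) :
  (forall i, measurable_fun setT (fun t => f t 0 i : measurableTypeR R)) ->
  measurable_fun setT f.
Proof.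
move=> mf; apply: (measurability _ (measurable_rV_boxes d)).
move=> A [_ [B mB <-] <-]; rewrite setTI.
rewrite (_ : _ @^-1` _ =
    \big[setI/setT]_(i < d) ((fun t => f t 0 i : measurableTypeR R) @^-1` B i)).
  by apply: bigsetI_measurable => i _; rewrite -[X in measurable X]setTI; exact: mf.
rewrite -bigcap_seq; apply/seteqP; split => x /= Bx i /=; first by move=> _; exact: Bx.
by apply: Bx; rewrite /= mem_index_enum.
Qed.

End volume.

(** * Invariance of Lebesgue measure *)

Definition pushforward_measure d1 d2 (T1 : measurableType d1)
    (T2 : measurableType d2) (R : realFieldType)
    (m : {measure set T1 -> \bar R}) (f : T1 -> T2)
    (mf : measurable_fun setT f) : {measure set T2 -> \bar R} :=
  measure_function_pushforward__canonical__measure_function_Measure m mf.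

Section affine.
Context {R : realType} (s : R).
Hypothesis s1 : s = 1 \/ s = -1.

(** It suffices to compare both measures on half-open intervals. The sign [s] treats translations
    and reflections at once. *)
Lemma lebesgue_measure_affine (c : R) (A : set (measurableTypeR R)) :
  measurable A ->
  lebesgue_measure ((fun x : measurableTypeR R => s * x + c : measurableTypeR R) @^-1` A)
  = lebesgue_measure A.
Proof.
set f : measurableTypeR R -> measurableTypeR R := fun x => _.
have mf : @measurable_fun _ _ (measurableTypeR R) (measurableTypeR R) setT f.
  apply: measurable_funD => //; exact: measurable_funM.
move=> mA; apply/esym.
pose m : {measure set (measurableTypeR R) -> \bar R} :=
  pushforward_measure lebesgue_measure mf.
suff mE X : ocitv X -> lebesgue_measure X = m X.
  exact: (lebesgue_measure_unique mE mA).
move=> [[a b] _ <-]; rewrite /m /= /pushforward {m}.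
case: s1 @f mf => -> f mf.
  rewrite (_ : f @^-1` _ = `]a - c, b - c]%classic); last first.
    by apply/seteqP; split => x /=; rewrite /f !in_itv /= mul1r ltrBlDr lerBrDr.
  rewrite !lebesgue_measure_itv /= !lte_fin ltrD2r.
  by case: ifP => // _; rewrite -!EFinD; congr EFin; lra.
(* A reflection moves the closed endpoint to the other side, which leaves the length unchanged. *)
rewrite (_ : f @^-1` _ = `[c - b, c - a[%classic); last first.
  by apply/seteqP; split => x /=; rewrite /f !in_itv /= => /andP[? ?];
    apply/andP; split; lra.
rewrite !lebesgue_measure_itv /= !lte_fin ltrD2l ltrN2.
by case: ifP => // _; rewrite -!EFinD; congr EFin; lra.
Qed.

Variables (d : nat) (v : 'rV[R]_d).

Definition affine (x : 'rV[R]_d) : 'rV[R]_d := s *: x + v.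

Lemma measurable_affine : measurable_fun setT affine.
Proof.
apply: measurable_rV => i.
apply: (eq_measurable_fun (fun x : 'rV[R]_d => s * x 0 i + v 0 i)).
  by move=> x _; rewrite !mxE.
apply: measurable_funD => //; apply: measurable_funM => //.
exact: measurable_coord.
Qed.

(** The preimage of a box is the box of the one-dimensional preimages, so [vol_unique] reduces the
    claim to a single coordinate. *)
Lemma vol_affine (A : set 'rV[R]_d) :
  measurable A -> vol d (affine @^-1` A) = vol d A.
Proof.
have mf := measurable_affine.
move=> mA; apply/esym; pose m : {measure set 'rV[R]_d -> \bar R} :=
  pushforward_measure (vol d) mf.
apply: (vol_unique (m := m)) => // {A mA} B mB; rewrite /m /= /pushforward {m}.
pose g i (x : measurableTypeR R) : measurableTypeR R := s * x + v 0 i.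
have mg i : measurable_fun setT (g i).
  apply: measurable_funD => //; exact: measurable_funM.
rewrite (_ : _ @^-1` _ = box (fun i => g i @^-1` B i)); last first.
  by apply/seteqP; split => x Bx i; have := Bx i; rewrite /affine /g !mxE.
rewrite !vol_box //; last by move=> i; rewrite -[X in measurable X]setTI; exact: mg.
by apply: eq_bigr => i _; exact: lebesgue_measure_affine.
Qed.

Lemma integrable_affine (f : 'rV[R]_d -> R) :
  (vol d).-integrable setT (EFin \o f) ->
  (vol d).-integrable setT (EFin \o (f \o affine)).
Proof.
have mT := measurable_affine.
move=> /integrableP[mf intf]; apply/integrableP; split.
  exact: (measurableT_comp mf mT).
rewrite (_ : (\int[_]_x _ = \int[pushforward (vol d) affine]_x `|(EFin \o f) x|)%E).
  rewrite (eq_measure_integral (vol d)) // => A mA _.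
  exact: vol_affine.
by rewrite [RHS]ge0_integral_pushforward //; exact: measurableT_comp.
Qed.

Lemma Rintegral_affine (f : 'rV[R]_d -> R) (D : set 'rV[R]_d) :
  measurable D -> (vol d).-integrable setT (EFin \o f) ->
  \int[vol d]_(x in affine @^-1` D) f (affine x) = \int[vol d]_(x in D) f x.
Proof.
move=> mD intf; have mT := measurable_affine; congr fine.
have mf : measurable_fun setT (EFin \o f) by case/integrableP : intf.
have ifT : (vol d).-integrable (affine @^-1` D) ((EFin \o f) \o affine).
  apply: integrableS (integrable_affine intf) => //.
  by rewrite -[X in measurable X]setTI; exact: mT.
rewrite -[LHS](integral_pushforward mT mf ifT mD).
by apply: eq_measure_integral => A mA _; exact: vol_affine.
Qed.

End affine.

Section translation.
Context {R : realType} (d : nat).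
Implicit Types (f : 'rV[R]_d -> R) (v : 'rV[R]_d).

Lemma integrable_shift f v : (vol d).-integrable setT (EFin \o f) ->
  (vol d).-integrable setT (EFin \o (fun x => f (x + v))).
Proof.
move=> /(@integrable_affine R 1 (or_introl erefl) d v); apply: eq_integrable => //.
by move=> x _; rewrite /= /affine scale1r.
Qed.

Lemma Rintegral_shift f v : (vol d).-integrable setT (EFin \o f) ->
  \int[vol d]_x f (x + v) = \int[vol d]_x f x.
Proof.
move=> intf; rewrite -[RHS](@Rintegral_affine R 1 (or_introl erefl) d v) //.
by rewrite preimage_setT; apply: eq_Rintegral => x _; rewrite /affine scale1r.
Qed.

Lemma integrable_reflect f v : (vol d).-integrable setT (EFin \o f) ->
  (vol d).-integrable setT (EFin \o (fun x => f (v - x))).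
Proof.
move=> /(@integrable_affine R (-1) (or_intror erefl) d v); apply: eq_integrable => //.
by move=> x _; rewrite /= /affine scaleN1r addrC.
Qed.

Lemma Rintegral_reflect f v (D E : set 'rV[R]_d) : measurable D ->
  (vol d).-integrable setT (EFin \o f) -> (forall x, E x <-> D (v - x)) ->
  \int[vol d]_(x in E) f (v - x) = \int[vol d]_(x in D) f x.
Proof.
move=> mD intf ED; rewrite -[RHS](@Rintegral_affine R (-1) (or_intror erefl) d v) //.
have -> : E = affine (-1) v @^-1` D.
  by apply/seteqP; split => x; rewrite /= /affine scaleN1r addrC => /ED.
by apply: eq_Rintegral => x _; rewrite /affine scaleN1r addrC.
Qed.

End translation.

(** * Multipliers preserving nonnegativity of the transform *)

Section multipliers.
Context {R : realType} {d : nat}.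
Implicit Types (f g : 'rV[R]_d -> R) (xi : 'rV[R]_d).

Lemma measurable_dot xi : measurable_fun setT (fun x : 'rV[R]_d => dot x xi).
Proof.
apply: measurable_sum => i; apply: measurable_funM => //; exact: measurable_coord.
Qed.

Lemma measurable_cosR : measurable_fun setT (@cos R).
Proof. exact: continuous_measurable_fun (@continuous_cos R). Qed.

Lemma measurable_cos_dot xi : measurable_fun setT (fun x : 'rV[R]_d => cos (dot x xi)).
Proof. exact: measurableT_comp measurable_cosR (measurable_dot xi). Qed.

Lemma dotDl (x y z : 'rV[R]_d) : dot (x + y) z = dot x z + dot y z.
Proof. by rewrite /dot -big_split; apply: eq_bigr => i _; rewrite !mxE mulrDl. Qed.

Lemma dotDr (x y z : 'rV[R]_d) : dot x (y + z) = dot x y + dot x z.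
Proof. by rewrite /dot -big_split; apply: eq_bigr => i _; rewrite !mxE mulrDr. Qed.

Lemma dotZr (a : R) (x y : 'rV[R]_d) : dot x (a *: y) = a * dot x y.
Proof. by rewrite /dot mulr_sumr; apply: eq_bigr => i _; rewrite !mxE mulrCA. Qed.

Lemma dotNr (x y : 'rV[R]_d) : dot x (- y) = - dot x y.
Proof. by rewrite -scaleN1r dotZr mulN1r. Qed.

Lemma dotNl (x y : 'rV[R]_d) : dot (- x) y = - dot x y.
Proof. by rewrite /dot -sumrN; apply: eq_bigr => i _; rewrite !mxE mulNr. Qed.

Lemma integrable_mulr_bounded f g (M : R) :
  (vol d).-integrable setT (EFin \o f) -> measurable_fun setT g ->
  (forall x, `|g x| <= M) ->
  (vol d).-integrable setT (EFin \o (fun x => f x * g x)).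
Proof.
move=> intf mg gM.
have mf : measurable_fun setT f by apply/measurable_EFinP; case/integrableP : intf.
apply: (@le_integrable _ _ _ _ _ _ _ (EFin \o (fun x => M * f x))) => //.
- by apply/measurable_EFinP; exact: measurable_funM.
- move=> x _; rewrite /= lee_fin !normrM mulrC ler_wpM2r //.
  by rewrite (le_trans (gM x)) // ler_norm.
- exact: (integrableZl measurableT M intf).
Qed.

Lemma integrable_cos f xi : (vol d).-integrable setT (EFin \o f) ->
  (vol d).-integrable setT (EFin \o (fun x => f x * cos (dot x xi))).
Proof.
move=> intf; apply: (@integrable_mulr_bounded _ _ 1) => // x.
  exact: measurable_cos_dot.
by rewrite ler_norml cos_geN1 cos_le1.
Qed.

(* The real part of the Fourier transform of [f] is nonnegative, the factor 2 pi
   being absorbed in [xi]. *)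
Definition cospos f := (vol d).-integrable setT (EFin \o f) /\
  forall xi, 0 <= \int[vol d]_x (f x * cos (dot x xi)).

Lemma cosposD f g : cospos f -> cospos g -> cospos (fun x => f x + g x).
Proof.
move=> [fi f0] [gi g0]; split; first exact: (integrableD measurableT fi gi).
move=> xi; under eq_Rintegral do rewrite mulrDl.
by rewrite RintegralD //; [exact: addr_ge0 | exact: integrable_cos | exact: integrable_cos].
Qed.

Lemma cosposZ (a : R) f : 0 <= a -> cospos f -> cospos (fun x => a * f x).
Proof.
move=> a0 [fi f0]; split; first exact: (integrableZl measurableT a fi).
move=> xi; under eq_Rintegral do rewrite -mulrA.
by rewrite RintegralZl //; [exact: mulr_ge0 | exact: integrable_cos].
Qed.

Lemma cospos_eq f g : f =1 g -> cospos f -> cospos g.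
Proof. by move=> /funext ->. Qed.

Lemma cospos_sum I (s : seq I) (F : I -> 'rV[R]_d -> R) :
  (forall i, cospos (F i)) -> cospos (fun x => \sum_(i <- s) F i x).
Proof.
move=> F0; elim: s => [|i s IH].
  apply: (@cospos_eq (fun=> 0)) => [x|]; first by rewrite big_nil.
  split; first exact: integrable0.
  by move=> xi; apply: Rintegral_ge0 => x _; rewrite mul0r.
by apply: cospos_eq (cosposD (F0 i) IH) => x; rewrite big_cons.
Qed.

(** By the product-to-sum formula, the new transform at [xi] is the mean of the old one at
    [eta - xi] and [eta + xi]. *)
Lemma cospos_cos f eta : cospos f -> cospos (fun x => f x * cos (dot x eta)).
Proof.
move=> [fi f0]; split; first exact: integrable_cos.
move=> xi.
have -> : \int[vol d]_x (f x * cos (dot x eta) * cos (dot x xi)) =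
    2^-1 * (\int[vol d]_x (f x * cos (dot x (eta - xi)))
            + \int[vol d]_x (f x * cos (dot x (eta + xi)))).
  rewrite -RintegralD //; [|exact: integrable_cos..].
  rewrite -RintegralZl //; last first.
    exact: (integrableD measurableT (integrable_cos _ fi) (integrable_cos _ fi)).
  apply: eq_Rintegral => x _.
  by rewrite !dotDr dotNr cosB cosD; field.
by rewrite mulr_ge0 // ?invr_ge0 // addr_ge0.
Qed.

Lemma cospos_cosX f eta n : cospos f -> cospos (fun x => f x * cos (dot x eta) ^+ n).
Proof.
move=> f0; elim: n => [|n IH].
  by apply: cospos_eq f0 => x; rewrite expr0 mulr1.
by apply: cospos_eq (cospos_cos eta IH) => x; rewrite exprSr mulrA.
Qed.

(** Dominated convergence with the bound [M * |f|] carries each inequality of [cospos] to the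
    limit. *)
Lemma cospos_limit f (g_ : nat -> 'rV[R]_d -> R) g (M : R) :
  (vol d).-integrable setT (EFin \o f) ->
  (forall n, measurable_fun setT (g_ n)) -> (forall n x, `|g_ n x| <= M) ->
  (forall x, g_ n x @[n --> \oo] --> g x) ->
  (forall n, cospos (fun x => f x * g_ n x)) -> cospos (fun x => f x * g x).
Proof.
move=> fi mg gM gg gpos.
have mg' : measurable_fun setT g.
  by apply: (measurable_fun_cvg mg) => x _; exact: gg.
have gM' x : `|g x| <= M.
  by apply: (cvgr_to_le (cvg_norm (gg x))); apply: nearW => n; exact: gM.
have fgi : (vol d).-integrable setT (EFin \o (fun x => f x * g x)).
  exact: integrable_mulr_bounded gM'.
split => // xi.
have M0 : 0 <= M by exact: le_trans (gM 0%N 0).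
have cvgI : \int[vol d]_x (f x * g_ n x * cos (dot x xi)) @[n --> \oo] -->
       \int[vol d]_x (f x * g x * cos (dot x xi)).
  apply: fine_cvg; rewrite fineK; last first.
    by apply: integrable_fin_num => //; exact: integrable_cos.
  apply: (@dominated_cvg _ _ _ _ _ _ _ _ (fun x => (M * `|f x|)%:E)) => //.
  - by move=> n; case/integrableP: (integrable_cos xi (gpos n).1).
  - move=> x _; apply: cvg_EFin; first exact: nearW.
    apply: cvgMl; apply: cvgMr; exact: gg.
  - exact: (integrableZl measurableT M (integrable_norm fi)).
  - move=> n x _; rewrite /= lee_fin [M * _]mulrC 2!normrM.
    apply: (@le_trans _ _ (`|f x| * `|g_ n x|)); last by rewrite ler_wpM2l.
    by rewrite ler_piMr ?mulr_ge0 // ler_norml cos_geN1 cos_le1.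
by apply: (cvgr_to_ge cvgI); apply: nearW => n; exact: (gpos n).2.
Qed.

Definition multiplier g := forall f, cospos f -> cospos (fun x => f x * g x).

Lemma measurable_expRcos (h : R -> R) xi : continuous h ->
  measurable_fun setT (fun x : 'rV[R]_d => h (cos (dot x xi))).
Proof.
move=> ch; apply: measurableT_comp (measurable_cos_dot xi).
exact: continuous_measurable_fun.
Qed.

(** The exponential series has nonnegative coefficients lam^k / k!, and powers of the cosine
    preserve [cospos]. Its partial sums are bounded by [expR lam] uniformly in [x]. *)
Lemma multiplier_expcos (lam : R) eta : 0 <= lam ->
  multiplier (fun x => expR (lam * (cos (dot x eta) - 1))).
Proof.
move=> lam0 f f0.
(* The constant factor exp(-lam) is split off; it serves to keep the multiplier at most 1 for every
   [lam]. *)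
suff H : cospos (fun x => f x * expR (lam * cos (dot x eta))).
  apply: cospos_eq (cosposZ (expR_ge0 (- lam)) H) => x.
  by rewrite mulrBr mulr1 expRD mulrCA [expR _ * expR _]mulrC.
apply: (@cospos_limit f (fun n x => series (exp_coeff (lam * cos (dot x eta))) n)
  _ (expR lam) f0.1).
- move=> n; rewrite /series /=; apply: measurable_sum => k.
  apply: (@measurable_expRcos (fun c => exp_coeff (lam * c) k)) => c.
  rewrite /exp_coeff /=; apply: cvgMl.
  apply: (@continuous_comp _ _ _ ( *%R lam) (fun y => y ^+ k)).
    by apply: cvgMr; exact: cvg_id.
  exact: exprn_continuous.
- move=> n x; apply: (@le_trans _ _ (series (exp_coeff lam) n)).
    rewrite /series /=; apply: le_trans (ler_norm_sum _ _ _) _.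
    apply: ler_sum => k _; rewrite /exp_coeff /= normrM normrX normrM.
    rewrite [`|_^-1|]ger0_norm // ler_wpM2r // lerXn2r ?nnegrE ?mulr_ge0 //.
    by rewrite (ger0_norm lam0) ler_piMr // ler_norml cos_geN1 cos_le1.
  apply: nondecreasing_cvgn_le; last exact: is_cvg_series_exp_coeff.
  apply/nondecreasing_seqP => k; rewrite /series /= big_nat_recr //= lerDl.
  exact: exp_coeff_ge0.
- move=> x; exact: is_cvg_series_exp_coeff.
- move=> n; rewrite /series /=.
  apply: (@cospos_eq (fun x => \sum_(0 <= k < n)
      (lam ^+ k / k`!%:R) * (f x * cos (dot x eta) ^+ k))).
    move=> x; rewrite mulr_sumr; apply: eq_bigr => k _.
    by rewrite /exp_coeff /= exprMn; ring.
  apply: cospos_sum => k; apply: cosposZ; last exact: cospos_cosX.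
  by rewrite divr_ge0 // exprn_ge0.
Qed.

(** With u = y / (2m), the identity cos(2u) - 1 = -2 sin(u)^2 reduces the limit to sin(u) / u
    tending to 1, the derivative of the sine at 0. *)
Lemma cvg_cos_quadratic (y : R) :
  (n.+1)%:R ^+ 2 * (cos (y / n.+1%:R) - 1) @[n --> \oo] --> - (y ^+ 2 / 2).
Proof.
have [->|y0] := eqVneq y 0.
  rewrite expr0n mul0r oppr0; apply: cvg_near_cst; apply: nearW => n.
  by rewrite mul0r cos0 subrr mulr0.
pose u n : R := y / 2 / n.+1%:R.
have u0 n : u n != 0 by rewrite /u !mulf_neq0 // invr_neq0.
have ucvg : u n @[n --> \oo] --> 0.
  rewrite -(mulr0 (y / 2)); apply: cvgMr; exact: cvg_harmonic.
have sincvg : (u n)^-1 * sin (u n) @[n --> \oo] --> (1 : R).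
  have [ds Ds] := @is_derive_sin R 0.
  have := ds; rewrite /derivable => /cvg_ex[l]; move: (ds) => _ cl.
  have l1 : l = 1 by rewrite -cos0 -Ds; apply/esym/cvg_lim.
  move: cl; rewrite l1 => /cvgr_dnbhsP/(_ u (conj u0 ucvg)).
  apply: cvg_trans; apply: near_eq_cvg; apply: nearW => n /=.
  by rewrite /shift /= addr0 sin0 subr0 scaler1.
have -> : (fun n => (n.+1)%:R ^+ 2 * (cos (y / n.+1%:R) - 1)) =
    (fun n => - (y ^+ 2 / 2) * ((u n)^-1 * sin (u n)) ^+ 2).
  apply/funext => n.
  have -> : y / n.+1%:R = u n *+ 2 by rewrite /u -mulr_natr; field; rewrite ?pnatr_eq0.
  have cs := cos2Dsin2 (u n); rewrite cos_mulr2n.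
  have -> : cos (u n) ^+ 2 *+ 2 - 1 - 1 = - 2 * sin (u n) ^+ 2.
    by rewrite -mulr_natr; lra.
  have N0 : (n.+1)%:R != 0 :> R by rewrite pnatr_eq0.
  rewrite /u; move: (sin _) => S; move: ((n.+1)%:R : R) N0 => N N0.
  by field; rewrite y0 N0.
rewrite -[X in _ --> X]mulr1; apply: cvgMr.
rewrite -(expr1n R 2).
exact: (cvg_comp _ _ sincvg (@exprn_continuous _ 2 1)).
Qed.

(** This is the limit of [multiplier_expcos] for lam = m^2 and eta / m; all exponents are
    nonpositive, hence the uniform bound 1. *)
Lemma multiplier_gauss1 eta : multiplier (fun x => expR (- (dot x eta ^+ 2 / 2))).
Proof.
move=> f f0.
apply: (@cospos_limit f
  (fun n x => expR ((n.+1)%:R ^+ 2 * (cos (dot x (n.+1%:R^-1 *: eta)) - 1))) _ 1 f0.1).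
- move=> n.
  apply: (@measurable_expRcos (fun c => expR ((n.+1)%:R ^+ 2 * (c - 1)))) => c.
  apply: continuous_comp; last exact: continuous_expR.
  apply: cvgMr; apply: cvgB; [exact: cvg_id|exact: cvg_cst].
- move=> n x; rewrite ger0_norm ?expR_ge0 // -[leRHS]expR0 ler_expR.
- move=> x.
  under eq_fun do rewrite dotZr mulrC [_^-1 * _]mulrC mulrC.
  apply: continuous_cvg; first exact: continuous_expR.
  exact: cvg_cos_quadratic.
- by move=> n; apply: multiplier_expcos f0; rewrite sqr_ge0.
Qed.

Lemma multiplier_gauss (s : R) : 0 <= s ->
  multiplier (fun x : 'rV[R]_d => expR (- (s * dot x x))).
Proof.
move=> s0 f f0.
suff H (r : seq 'I_d) : cospos (fun x => f x * \prod_(i <- r) expR (- (s * x 0 i ^+ 2))).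
  apply: cospos_eq (H (index_enum _)) => x.
  rewrite -expR_sum /dot sumrN -mulr_sumr.
  by under eq_bigr do rewrite expr2.
elim: r => [|i r IH].
  by apply: cospos_eq f0 => x; rewrite big_nil mulr1.
(* The Gaussian is a product over the coordinates; the scaling by sqrt(2s) turns (x . eta)^2 / 2
   into s x_i^2. *)
apply: cospos_eq (multiplier_gauss1 (Num.sqrt (2 * s) *: delta_mx 0 i) IH) => x.
rewrite big_cons -mulrA; congr (_ * _); rewrite mulrC; congr (expR (- _) * _).
rewrite dotZr exprMn sqr_sqrtr ?mulr_ge0 //.
have -> : dot x (delta_mx 0 i) = x 0 i.
  rewrite /dot (bigD1 i) //= big1 ?addr0 ?mxE ?eqxx ?mulr1 // => j ji.
  by rewrite mxE (negbTE ji) andbF mulr0.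
by field.
Qed.

End multipliers.

(** * Continuous functions with nonnegative transform *)

Section positive_definite.
Context {R : realType} {d : nat}.
Implicit Types (f g : 'rV[R]_d -> R) (xi v : 'rV[R]_d).

Lemma Rintegral_sum (D : set 'rV[R]_d) I (s : seq I) (F : I -> 'rV[R]_d -> R) :
  measurable D -> (forall i, (vol d).-integrable D (EFin \o F i)) ->
  \int[vol d]_(x in D) (\sum_(i <- s) F i x) =
  \sum_(i <- s) \int[vol d]_(x in D) F i x.
Proof.
move=> mD Fi; rewrite /Rintegral; under eq_integral do rewrite -sumEFin.
rewrite integral_sum // -sum_fine // => i _.
exact: (integrable_fin_num mD (Fi i)).
Qed.

Lemma integrable_sumr (D : set 'rV[R]_d) I (s : seq I) (F : I -> 'rV[R]_d -> R) :
  measurable D -> (forall i, (vol d).-integrable D (EFin \o F i)) ->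
  (vol d).-integrable D (EFin \o (fun x => \sum_(i <- s) F i x)).
Proof.
move=> mD Fi; rewrite (_ : _ \o _ = fun x => (\sum_(i <- s) (F i x)%:E)%E).
  exact: (integrable_sum mD s (P := xpredT) (fun i _ => Fi i)).
by apply/funext => x; rewrite /= sumEFin.
Qed.

Lemma integrableZ_fin (a : R) f : (vol d).-integrable setT (EFin \o f) ->
  (vol d).-integrable setT (EFin \o (fun x => a * f x)).
Proof. exact: integrableZl. Qed.

Lemma integrableD_fin f g : (vol d).-integrable setT (EFin \o f) ->
  (vol d).-integrable setT (EFin \o g) ->
  (vol d).-integrable setT (EFin \o (fun x => f x + g x)).
Proof. exact: integrableD. Qed.

Lemma integrable_ccube_indic (r : R) : 0 <= r ->
  (vol d).-integrable setT (EFin \o (\1_(@ccube R d r) : 'rV[R]_d -> R)).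
Proof.
move=> r0; apply/integrableP; split.
  by apply/measurable_EFinP; apply: measurable_indic; exact: measurable_ccube.
under eq_integral do rewrite /= ger0_norm //.
by rewrite integral_indic ?setIT ?vol_ccube ?ltry //; exact: measurable_ccube.
Qed.

Lemma Rintegral_ccube_indic (r : R) : 0 <= r ->
  \int[vol d]_x (\1_(@ccube R d r) x : R) = (2 * r) ^+ d.
Proof.
move=> r0; rewrite /Rintegral integral_indic ?setIT ?vol_ccube //.
exact: measurable_ccube.
Qed.

(** Cubes stand in for Euclidean balls because their volume is explicit; this bound and the next
    compare the two. *)
Lemma dot_ccube (r : R) (x : 'rV[R]_d) : ccube r x -> dot x x <= d%:R * r ^+ 2.
Proof.
move=> xr; rewrite mulr_natl -[d in X in _ <= X]card_ord -sumr_const.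
apply: ler_sum => i _; have := xr i; rewrite /= in_itv /= => /andP[? ?].
by nra.
Qed.

Lemma dot_ccubeN (r : R) (x : 'rV[R]_d) : 0 <= r -> ~ ccube r x -> r ^+ 2 <= dot x x.
Proof.
move=> r0 xr; have [i xi] : exists i, ~ (- r <= x 0 i <= r).
  apply/existsNP => H; apply: xr => i; rewrite /= in_itv /=; exact: H.
rewrite /dot (bigD1 i) //=; apply: (@le_trans _ _ (x 0 i * x 0 i)).
  by move/negP: xi; rewrite negb_and -!ltNge => /orP[] ?; nra.
by rewrite lerDl sumr_ge0 // => j _; rewrite -expr2 sqr_ge0.
Qed.

(* Laplace's method: tested against the Gaussians exp(-n|x|^2), only the sign
   of [f] near 0 matters. *)
Lemma cospos_ge0 f : cospos f -> {for 0, continuous f} -> 0 <= f 0.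
Proof.
move=> f0 cf; rewrite leNgt; apply/negP => fneg.
pose eta := - (f 0 / 2); have eta0 : 0 < eta by rewrite /eta; lra.
have [e e0 fe] : exists2 e : R, 0 < e & forall x, ccube e x -> f x <= - eta.
  have : \forall x \near (0 : 'rV[R]_d), f x < - eta.
    by apply: (cvgr_lt (f 0) cf); rewrite /eta; lra.
  move=> /nbhs_ballP[e /= e0 He]; exists (e / 2) => [|x xe]; first by rewrite divr_gt0.
  apply/ltW/He; split => // i j; rewrite (ord1 i) mxE /ball /= sub0r normrN.
  apply: (@le_lt_trans _ _ (e / 2)); last by rewrite ltr_pdivrMr // mulr2n mulrDr mulr1 ltrDl.
  by have := xe j; rewrite /= in_itv /= ler_norml.
(* Small enough that |x|^2 <= e^2 / 2 on the cube of half-side [e'], while |x|^2 >= e^2 outside that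
   of half-side [e]. With [k] = exp(-n e^2 / 2), the Gaussian is at least [k] on the former and at
   most k^2 outside the latter. *)
pose e' := e / (2 * d.+1%:R).
have e'0 : 0 < e' by rewrite /e' divr_gt0 // mulr_gt0.
have e'e : d%:R * e' ^+ 2 <= e ^+ 2 / 2 /\ e' <= e.
  have d0 : 0 <= d%:R :> R by [].
  have e'E : e = e' * (2 * (1 + d%:R)).
    by rewrite /e' -nat1r; field; rewrite nat1r pnatr_eq0.
  by rewrite e'E; split; nra.
pose V : R := (2 * e') ^+ d; pose J := \int[vol d]_x `|f x|.
have V0 : 0 < V by rewrite exprn_gt0 // mulr_gt0.
have J0 : 0 <= J by apply: Rintegral_ge0.
have key (n : nat) : eta * V * (1 + n%:R * (e ^+ 2 / 2)) <= J.
  pose k := expR (- (n%:R * (e ^+ 2 / 2))).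
  have k0 : 0 < k by exact: expR_gt0.
  (* The integrand dominates [f] times the Gaussian: separately outside the large cube, between the
     two cubes, and in the small one. *)
  have : 0 <= \int[vol d]_x (- (eta * k) * \1_(@ccube R d e') x + k ^+ 2 * `|f x|).
    have [gi /(_ 0)] := multiplier_gauss (ler0n R n) f0.
    have -> : \int[vol d]_x (f x * expR (- (n%:R * dot x x)) * cos (dot x 0)) =
              \int[vol d]_x (f x * expR (- (n%:R * dot x x))).
      apply: eq_Rintegral => x _; rewrite (_ : dot x 0 = 0) ?cos0 ?mulr1 //.
      by rewrite -(scale0r 0) dotZr mul0r.
    move=> /le_trans; apply; apply: le_Rintegral => //.
      apply: integrableD_fin; apply: integrableZ_fin.
        exact/integrable_ccube_indic/ltW.
      exact: integrable_norm f0.1.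
    move=> x _; set G := expR _; have G0 : 0 < G by exact: expR_gt0.
    have [xe|xe] := pselect (ccube e x); last first.
      have Gk : G <= k ^+ 2.
        rewrite /G /k expr2 -expRD ler_expR.
        by have := ler_wpM2l (ler0n R n) (dot_ccubeN (ltW e0) xe); lra.
      rewrite indicE memNset => [|xe'].
        rewrite mulr0 add0r mulrC; apply: (@le_trans _ _ (G * `|f x|)).
          by rewrite ler_wpM2l ?(ltW G0) // ler_norm.
        by rewrite ler_wpM2r.
      apply: xe => i; have := xe' i; rewrite /= !in_itv /=; have [_ ?] := e'e.
      by move=> /andP[? ?]; apply/andP; split; lra.
    have fx := fe x xe.
    apply: (@le_trans _ _ (- (eta * k) * \1_(@ccube R d e') x)); last first.
      by rewrite lerDl mulr_ge0 // exprn_ge0 // ltW.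
    rewrite indicE; case: (asboolP (ccube e' x)) => xe'; last first.
      rewrite memNset // mulr0; nra.
    rewrite mem_set //= mulr1.
    have kG : k <= G.
      rewrite /G /k ler_expR lerN2; apply: ler_wpM2l => //.
      exact: le_trans (dot_ccube xe') e'e.1.
    by nra.
  have ii := integrable_ccube_indic (ltW e'0); have nf := integrable_norm f0.1.
  rewrite (RintegralD measurableT (integrableZ_fin _ ii) (integrableZ_fin _ nf)).
  rewrite (RintegralZl _ measurableT ii) (RintegralZl _ measurableT nf).
  rewrite (Rintegral_ccube_indic (ltW e'0)) -/V -/J => H.
  have {H} : eta * V <= k * J.
    by rewrite -(ler_pM2l k0); move: H; rewrite expr2; lra.
  (* By 1 + a <= exp(a), the exponential decay in [n] is traded for a linear bound, which fails for
     large [n]. *)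
  have : (1 + n%:R * (e ^+ 2 / 2)) * k <= 1.
    rewrite -[leRHS](expRxMexpNx_1 (n%:R * (e ^+ 2 / 2))).
    by rewrite ler_wpM2r ?(ltW k0) // expR_ge1Dx.
  set c := 1 + _ => ck Hk.
  have c0 : 0 <= c by rewrite /c addr_ge0 // mulr_ge0 // divr_ge0 // sqr_ge0.
  apply: (@le_trans _ _ (c * k * J)); last by rewrite ler_piMl.
  by rewrite mulrC -mulrA ler_wpM2l.
pose w := eta * V * (e ^+ 2 / 2).
have w0 : 0 < w by rewrite !mulr_gt0 // exprn_gt0.
have := key (Num.truncn (J / w)).+1; apply/negP; rewrite -ltNge.
have := truncnS_gt (J / w); rewrite ltr_pdivrMr // => H.
rewrite mulrDr mulr1; apply: (lt_le_trans H).
rewrite /w mulrA; rewrite -subr_ge0.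
have : 0 < eta * V by rewrite mulr_gt0.
by lra.
Qed.

End positive_definite.

(** * Positive definiteness, uniqueness and evenness *)

Section quadratic_form.
Context {R : realType} {d : nat}.
Implicit Types (f F : 'rV[R]_d -> R) (xi v : 'rV[R]_d).

Lemma measurable_sinR : measurable_fun setT (@sin R).
Proof. exact: continuous_measurable_fun (@continuous_sin R). Qed.

Lemma integrable_sin f xi : (vol d).-integrable setT (EFin \o f) ->
  (vol d).-integrable setT (EFin \o (fun x => f x * sin (dot x xi))).
Proof.
move=> intf; apply: (@integrable_mulr_bounded _ _ _ _ 1 intf).
  exact: measurableT_comp measurable_sinR (measurable_dot xi).
by move=> x; rewrite ler_norml sin_geN1 sin_le1.
Qed.

(** The real form of the rule that a translation multiplies the transform by a character. *)
Lemma Rintegral_shift_cos f v xi : (vol d).-integrable setT (EFin \o f) ->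
  \int[vol d]_x (f (x + v) * cos (dot x xi)) =
  cos (dot v xi) * \int[vol d]_x (f x * cos (dot x xi)) +
  sin (dot v xi) * \int[vol d]_x (f x * sin (dot x xi)).
Proof.
move=> fi; have ci := integrable_cos xi fi; have si := integrable_sin xi fi.
rewrite -(RintegralZl _ measurableT ci) -(RintegralZl _ measurableT si).
rewrite -(RintegralD measurableT (integrableZ_fin _ ci) (integrableZ_fin _ si)).
have i0 := integrableD_fin (integrableZ_fin (cos (dot v xi)) ci)
                           (integrableZ_fin (sin (dot v xi)) si).
rewrite -(Rintegral_shift v i0); apply: eq_Rintegral => x _.
have -> : cos (dot x xi) = cos (dot (x + v) xi - dot v xi) by rewrite dotDl addrK.
by rewrite cosB; ring.
Qed.

Lemma continuous_shift F v : continuous F ->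
  continuous (fun x : 'rV[R]_d => F (x + v)).
Proof.
move=> cF x; apply: (@continuous_comp _ _ _ (fun y : 'rV[R]_d => y + v) F); last exact: cF.
exact: (cvgD cvg_id (cvg_cst v)).
Qed.

Lemma continuous_sumr I (s : seq I) (G : I -> 'rV[R]_d -> R) :
  (forall i, continuous (G i)) -> continuous (fun x => \sum_(i <- s) G i x).
Proof.
move=> cG; elim: s => [|i s IH].
  rewrite (_ : (fun x => _) = cst 0); first exact: cst_continuous.
  by apply/funext => x; rewrite big_nil.
rewrite (_ : (fun x => _) = fun x => G i x + \sum_(j <- s) G j x).
  by move=> x; exact: (cvgD (cG i x) (IH x)).
by apply/funext => x; rewrite big_cons.
Qed.

Definition quadform F (s : seq (R * 'rV[R]_d)) : R :=
  \sum_(p <- s) \sum_(q <- s) p.1 * q.1 * F (p.2 - q.2).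

(** The form is the value at 0 of [Phi], a sum of translates of [F]. The cosine transform of [Phi]
    is that of [F] times the squared modulus of the exponential sum of the configuration, so
    [cospos_ge0] applies. Vanishing sine integrals say that the transform of [F] is real. *)
Lemma cospos_quadform F s : cospos F -> continuous F ->
  (forall xi, \int[vol d]_x (F x * sin (dot x xi)) = 0) -> 0 <= quadform F s.
Proof.
move=> [Fi F0] cF Fs.
pose Phi z := \sum_(p <- s) \sum_(q <- s) p.1 * q.1 * F (z + (p.2 - q.2)).
have -> : quadform F s = Phi 0.
  by apply: eq_bigr => p _; apply: eq_bigr => q _; rewrite add0r.
have Phii p q : (vol d).-integrable setT
    (EFin \o (fun z => p.1 * q.1 * F (z + (p.2 - q.2)))).
  by apply: integrableZ_fin; exact: integrable_shift.
apply: cospos_ge0; last first.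
  move: (0 : 'rV[R]_d); apply: continuous_sumr => p; apply: continuous_sumr => q z.
  have cz := @continuous_shift _ (p.2 - q.2) cF z.
  exact: (cvgM (cvg_cst (p.1 * q.1)) cz).
split.
  exact: (integrable_sumr s measurableT (fun p => integrable_sumr s measurableT (Phii p))).
move=> xi; under eq_Rintegral do rewrite mulr_suml.
rewrite (Rintegral_sum _ measurableT) => [|p]; last first.
  under eq_fun do rewrite mulr_suml; apply: (integrable_sumr _ measurableT) => q.
  exact: integrable_cos.
rewrite [leRHS](_ : _ = \sum_(p <- s) \sum_(q <- s)
    (p.1 * q.1 * cos (dot p.2 xi - dot q.2 xi)) * \int[vol d]_x (F x * cos (dot x xi))).
  (* The cosine of a difference splits the double sum into two squares. *)
  rewrite [leRHS](_ : _ = ((\sum_(p <- s) p.1 * cos (dot p.2 xi)) ^+ 2 +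
    (\sum_(p <- s) p.1 * sin (dot p.2 xi)) ^+ 2) * \int[vol d]_x (F x * cos (dot x xi))).
    by rewrite mulr_ge0 ?F0 // addr_ge0 // sqr_ge0.
  rewrite !expr2 !mulr_suml -big_split /= mulr_suml; apply: eq_bigr => p _.
  rewrite !mulr_sumr -big_split /= mulr_suml; apply: eq_bigr => q _.
  by rewrite cosB; ring.
apply: eq_bigr => p _; under eq_Rintegral do rewrite mulr_suml.
rewrite (Rintegral_sum _ measurableT) => [|q]; last exact: integrable_cos.
apply: eq_bigr => q _; under eq_Rintegral do rewrite -mulrA.
rewrite RintegralZl //; last by apply: integrable_cos; exact: integrable_shift.
by rewrite Rintegral_shift_cos // Fs mulr0 addr0 mulrA dotDl dotNl.
Qed.

(** If the transform vanishes, every translate of [F] and of its negative satisfies [cospos], so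
    [cospos_ge0] gives both signs at [v]. *)
Lemma fourier0_eq0 F : (vol d).-integrable setT (EFin \o F) -> continuous F ->
  (forall xi, \int[vol d]_x (F x * cos (dot x xi)) = 0) ->
  (forall xi, \int[vol d]_x (F x * sin (dot x xi)) = 0) -> forall v, F v = 0.
Proof.
move=> Fi cF Fc Fs v; have Fvi := integrable_shift v Fi.
have shift0 xi : \int[vol d]_x (F (x + v) * cos (dot x xi)) = 0.
  by rewrite Rintegral_shift_cos // Fc Fs !mulr0 addr0.
apply/le_anti/andP; split; last first.
  rewrite -[X in F X]add0r; apply: (@cospos_ge0 _ _ (fun x => F (x + v))).
    by split=> // xi; rewrite shift0.
  exact: continuous_shift.
rewrite -oppr_ge0 -[X in F X]add0r; apply: (@cospos_ge0 _ _ (fun x => - F (x + v))).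
  split; first by under eq_fun do rewrite -mulN1r; exact: integrableZ_fin.
  move=> xi; under eq_Rintegral do rewrite -mulN1r -mulrA.
  by rewrite RintegralZl ?shift0 ?mulr0 //; exact: integrable_cos.
exact: (cvgN (@continuous_shift _ v cF 0)).
Qed.

(** The difference F(x) - F(-x) has zero cosine transform by reflection and zero sine transform by
    assumption, hence vanishes. *)
Lemma cospos_even F : cospos F -> continuous F ->
  (forall xi, \int[vol d]_x (F x * sin (dot x xi)) = 0) -> forall x, F (- x) = F x.
Proof.
move=> [Fi F0] cF Fs x.
have refl (g : 'rV[R]_d -> R) : (vol d).-integrable setT (EFin \o g) ->
    \int[vol d]_x g (- x) = \int[vol d]_x g x.
  move=> gi; rewrite -[RHS](@Rintegral_reflect _ _ g 0 setT setT) //.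
  by apply: eq_Rintegral => y _; rewrite sub0r.
have FNi : (vol d).-integrable setT (EFin \o (fun x => F (- x))).
  by have := integrable_reflect 0 Fi; under eq_fun do rewrite sub0r.
have FNi' : (vol d).-integrable setT (EFin \o (fun x => - F (- x))).
  by under eq_fun do rewrite -mulN1r; exact: integrableZ_fin.
apply/esym/eqP; rewrite -subr_eq0; apply/eqP.
apply: (@fourier0_eq0 (fun x => F x - F (- x))).
- exact: integrableD_fin.
- have cN : continuous (fun y : 'rV[R]_d => F (- y)).
    move=> y; apply: (@continuous_comp _ _ _ (fun z : 'rV[R]_d => - z) F).
      exact: oppr_continuous.
    exact: cF.
  by move=> y; exact: (cvgB (cF y) (cN y)).
- move=> xi; under eq_Rintegral do rewrite mulrBl.
  rewrite RintegralB //; [|exact: integrable_cos..].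
  rewrite -(refl _ (integrable_cos xi FNi)).
  under [X in _ - X]eq_Rintegral do rewrite opprK dotNl cosN.
  by rewrite subrr.
- move=> xi; under eq_Rintegral do rewrite mulrBl.
  rewrite RintegralB //; [|exact: integrable_sin..].
  rewrite -(refl _ (integrable_sin xi FNi)).
  under [X in _ - X]eq_Rintegral do rewrite opprK dotNl sinN mulrN -mulN1r.
  by rewrite RintegralZl ?Fs ?mulr0 ?subr0 //; exact: integrable_sin.
Qed.

Lemma cospos_gt0 F : cospos F -> continuous F ->
  (forall xi, \int[vol d]_x (F x * sin (dot x xi)) = 0) ->
  (exists x, F x != 0) -> 0 < F 0.
Proof.
move=> F0 cF Fs [x Fx]; rewrite lt0r (cospos_ge0 F0 (cF 0)) andbT.
apply: contra_neq Fx => F00.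
have even := cospos_even F0 cF Fs.
(* If F(0) = 0, the form on the points [x] and 0 with weights [a] and 1 is 2 a F(x), which has both
   signs unless F(x) = 0. *)
have H (a : R) : 0 <= 2 * a * F x.
  have := cospos_quadform [:: (a, x); (1, 0)] F0 cF Fs.
  rewrite /quadform !big_cons !big_nil /= !subrr subr0 sub0r even F00.
  by rewrite !mulr0 !addr0 !add0r !mulr1 !mul1r; lra.
by have := H 1; have := H (-1); lra.
Qed.

End quadratic_form.

(** * Testing with a cube *)

Section averaging.
Context {R : realType} {d : nat}.
Variable F : 'rV[R]_d -> R.
Hypothesis F_pd : forall s, 0 <= quadform F s.
Hypothesis F_even : forall x, F (- x) = F x.
Hypothesis F_int : (vol d).-integrable setT (EFin \o F).
Variables (C : set 'rV[R]_d) (V : R) (u : 'rV[R]_d -> R).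
Hypothesis mC : measurable C.
Hypothesis volC : vol d C = V%:E.
Hypothesis V0 : 0 < V.

(** The convolution of [F] with the indicator of [C]. Its integral over [C] is replaced by that of a
    majorant [u], so that integrability is asked of [u] alone. *)
Definition conv_on (x : 'rV[R]_d) : R := \int[vol d]_(y in C) F (x - y).

Hypothesis u_int : (vol d).-integrable C (EFin \o u).
Hypothesis conv_le : forall y, C y -> conv_on y <= u y.

Let phi := conv_on.
Let W := \int[vol d]_(y in C) u y.

Lemma quadform_cons b y s : quadform F ((b, y) :: s) =
  b ^+ 2 * F 0 + 2 * b * (\sum_(p <- s) p.1 * F (p.2 - y)) + quadform F s.
Proof.
rewrite /quadform big_cons /= big_cons /= subrr.
under eq_bigr do rewrite -opprB F_even.
under [X in _ + X]eq_bigr do rewrite big_cons /=.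
rewrite big_split /=.
have -> : \sum_(p <- s) b * p.1 * F (p.2 - y) = b * \sum_(p <- s) p.1 * F (p.2 - y).
  by rewrite mulr_sumr; apply: eq_bigr => p _; rewrite mulrA.
have -> : \sum_(p <- s) p.1 * b * F (p.2 - y) = b * \sum_(p <- s) p.1 * F (p.2 - y).
  by rewrite mulr_sumr; apply: eq_bigr => p _; rewrite mulrA [b * _]mulrC.
by ring.
Qed.

(* Adding to the configuration a point of mass [b], uniformly distributed in
   [C], and averaging. With [b = - c V / M] and [M] tending to infinity, the
   added points become the measure [- c dy] on [C], so that a double integral
   of [F] never occurs. *)
Lemma quadform_average (M : nat) (b : R) s :
  0 <= quadform F s + 2 * b * M%:R * ((\sum_(p <- s) p.1 * phi p.2) / V) +
       b ^+ 2 * (M%:R * F 0 + M%:R * (M%:R - 1) * W / V ^+ 2).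
Proof.
elim: M s => [|M IH] s; first by rewrite !mulr0 !mul0r !addr0 mulr0 addr0.
(* The induction hypothesis for [(b, y) :: s] splits into [c0], free of [y], a sum linear in F(p -
   y), and [e] times the convolution at [y]. *)
pose c0 := quadform F s + b ^+ 2 * F 0 +
  2 * b * M%:R * ((\sum_(p <- s) p.1 * phi p.2) / V) +
  b ^+ 2 * (M%:R * F 0 + M%:R * (M%:R - 1) * W / V ^+ 2).
pose e := 2 * b ^+ 2 * M%:R / V.
have e0 : 0 <= e.
  by apply: divr_ge0; [rewrite mulr_ge0 // mulr_ge0 // sqr_ge0 | exact: ltW].
have Fp (p : R * 'rV[R]_d) : (vol d).-integrable C (EFin \o (fun y => p.1 * F (p.2 - y))).
  by apply: (integrableS measurableT) => //; apply: integrableZ_fin; exact: integrable_reflect.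
have ci : (vol d).-integrable C (EFin \o (fun=> c0)).
  apply: measurable_bounded_integrable => //; first by rewrite volC ltry.
  by exists `|c0|; split => // z cz y _; exact: ltW.
have si := integrable_sumr s mC Fp.
have si' : (vol d).-integrable C
    (EFin \o (fun y => 2 * b * \sum_(p <- s) p.1 * F (p.2 - y))).
  exact: (integrableZl mC (2 * b) si).
have ui : (vol d).-integrable C (EFin \o (fun y => e * u y)).
  exact: (integrableZl mC e u_int).
have csi : (vol d).-integrable C
    (EFin \o (fun y => c0 + 2 * b * \sum_(p <- s) p.1 * F (p.2 - y))).
  exact: (integrableD mC ci si').
have : 0 <= \int[vol d]_(y in C) (c0 + 2 * b * (\sum_(p <- s) p.1 * F (p.2 - y)) + e * u y).
  apply: Rintegral_ge0 => y Cy.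
  apply: le_trans (IH ((b, y) :: s)) _; rewrite quadform_cons big_cons /=.
  have : e * phi y <= e * u y by rewrite ler_wpM2l // conv_le.
  rewrite /c0 /e mulrDl; lra.
rewrite RintegralD // RintegralD // RintegralZl // RintegralZl // Rintegral_cst // volC /=.
rewrite Rintegral_sum //.
rewrite (eq_bigr (fun p => p.1 * phi p.2)); last first.
  move=> p _; rewrite RintegralZl //; apply: (integrableS measurableT) => //.
  exact: integrable_reflect.
rewrite -/W => H.
(* Division by [V] gives the mean over [y]; the pair count grows by M(M - 1) + 2M = (M + 1)M. *)
have {H} : 0 <= (c0 * V + 2 * b * (\sum_(p <- s) p.1 * phi p.2) + e * W) / V.
  by rewrite divr_ge0 // ltW.
congr (0 <= _).
by rewrite /c0 /e -nat1r; field; rewrite gt_eqF.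
Qed.

Lemma quadform_conv_ge0 (c : R) s :
  0 <= quadform F s - 2 * c * (\sum_(p <- s) p.1 * phi p.2) + c ^+ 2 * W.
Proof.
(* With b = -cV / M the average equals T + e / M; a negative [T] is refuted by a large [M]. *)
set T := _ + _; pose e := c ^+ 2 * (V ^+ 2 * F 0 - W).
have key (M : nat) : 0 <= T + e / M.+1%:R.
  have := quadform_average M.+1 (- (c * V / M.+1%:R)) s.
  congr (_ <= _); rewrite /T /e; have : (M.+1)%:R != 0 :> R by rewrite pnatr_eq0.
  move: (M.+1%:R : R) => N N0; field.
  by rewrite N0 gt_eqF.
rewrite leNgt; apply/negP => T0.
have := key (Num.truncn (e / - T)); apply/negP; rewrite -ltNge.
have := truncnS_gt (e / - T); rewrite ltr_pdivrMr ?oppr_gt0 // => H.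
by rewrite -ltrBrDl sub0r ltr_pdivrMr // mulrC.
Qed.

End averaging.

(** * Counting centers in a cube *)

Section counting.
Context {R : realType} {d : nat}.
Variable F : 'rV[R]_d -> R.
Hypothesis F_pd : forall s, 0 <= quadform F s.
Hypothesis F_even : forall x, F (- x) = F x.
Hypothesis F_int : (vol d).-integrable setT (EFin \o F).

Let Fh := \int[vol d]_x F x.
Let J := \int[vol d]_x `|F x|.
Let tail (s : R) := \int[vol d]_(x in ~` ccube s) `|F x|.

Lemma Rintegral_subset (A B : set 'rV[R]_d) (f : 'rV[R]_d -> R) :
  measurable A -> measurable B -> A `<=` B -> (forall x, 0 <= f x) ->
  (vol d).-integrable setT (EFin \o f) ->
  \int[vol d]_(x in A) f x <= \int[vol d]_(x in B) f x.
Proof.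
move=> mA mB AB f0 fi.
have [fA fB] : (vol d).-integrable A (EFin \o f) /\ (vol d).-integrable B (EFin \o f).
  by split; apply: integrableS fi.
rewrite /Rintegral fine_le ?(integrable_fin_num mA fA) ?(integrable_fin_num mB fB) //.
apply: ge0_subset_integral => //; last by move=> x _; rewrite lee_fin.
by case/integrableP: fB.
Qed.

Lemma conv_onE (C : set 'rV[R]_d) (x : 'rV[R]_d) : measurable C ->
  exists2 D : set 'rV[R]_d, measurable D &
    (forall z : 'rV[R]_d, D z <-> C (x - z)) /\
    conv_on F C x = \int[vol d]_(z in D) F z.
Proof.
move=> mC; exists (affine (-1) x @^-1` C).
  by rewrite -[X in measurable X]setTI; apply: measurable_affine.
have DE (z : 'rV[R]_d) : affine (-1) x z = x - z by rewrite /affine scaleN1r addrC.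
split; first by move=> z; rewrite /= DE.
apply: Rintegral_reflect => //.
  by rewrite -[X in measurable X]setTI; apply: measurable_affine.
by move=> y; rewrite /= DE opprB addrCA subrr addr0.
Qed.

Lemma conv_on_le (C : set 'rV[R]_d) (x : 'rV[R]_d) : measurable C ->
  conv_on F C x <= J.
Proof.
move=> mC; have [D mD [_ ->]] := conv_onE x mC.
apply: (@le_trans _ _ (\int[vol d]_(z in D) `|F z|)).
  apply: (le_trans (ler_norm _)); apply: le_normr_Rintegral => //.
  exact: integrableS F_int.
apply: Rintegral_subset => //; exact: integrable_norm.
Qed.

(** The reflected cube x - C contains the cube of half-side [s] about 0, so only mass of [F] outside
    the latter is missed. *)
Lemma conv_on_ccube (r s : R) (x : 'rV[R]_d) : ccube r x ->
  `|conv_on F (ccube (r + s)) x - \int[vol d]_z F z| <= tail s.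
Proof.
move=> xr; have [D mD [DE ->]] := conv_onE x (@measurable_ccube R d (r + s)).
have sD : ccube s `<=` D.
  move=> z zs; apply/DE => i; have := xr i; have := zs i.
  by rewrite /= !in_itv /= !mxE => /andP[? ?] /andP[? ?]; apply/andP; split; lra.
have mDC : measurable (~` D) by exact: measurableC.
have -> : \int[vol d]_z F z = \int[vol d]_(z in D) F z + \int[vol d]_(z in ~` D) F z.
  rewrite -Rintegral_setU ?setUv //.
  apply/disj_setPS; rewrite setICr; exact: subset_refl.
rewrite opprD addNKr normrN.
apply: (@le_trans _ _ (\int[vol d]_(z in ~` D) `|F z|)).
  by apply: le_normr_Rintegral => //; exact: integrableS F_int.
have mS : measurable (~` @ccube R d s) by apply: measurableC; exact: measurable_ccube.
exact: (Rintegral_subset mDC mS (subsetC sD) (fun=> normr_ge0 _) (integrable_norm F_int)).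
Qed.

Lemma sumr_seq_cst I (s : seq I) (a : R) : \sum_(i <- s) a = (size s)%:R * a.
Proof. by rewrite big_const_seq count_predT iter_addr_0 mulr_natl. Qed.

(** The diagonal contributes |A| F(0), and every other term is nonpositive. *)
Lemma quadform_le (A : seq 'rV[R]_d) : uniq A ->
  (forall x y, x \in A -> y \in A -> x != y -> F (x - y) <= 0) ->
  quadform F [seq (1, x) | x <- A] <= (size A)%:R * F 0.
Proof.
move=> uA AF; rewrite /quadform big_map -sumr_seq_cst.
rewrite [leLHS]big_seq [leRHS]big_seq; apply: ler_sum => x xA /=.
rewrite big_map (bigD1_seq x) //= subrr !mul1r gerDl big_seq_cond.
by apply: sumr_le0 => y /andP[yA yx]; rewrite !mul1r AF // eq_sym.
Qed.

Lemma counting_bound (r s c : R) (A : seq 'rV[R]_d) :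
  0 <= r -> 0 < s -> 0 <= c -> uniq A -> (forall x, x \in A -> ccube r x) ->
  (forall x y, x \in A -> y \in A -> x != y -> F (x - y) <= 0) ->
  0 <= (size A)%:R * F 0 - 2 * c * ((size A)%:R * (Fh - tail s)) +
       c ^+ 2 * (J * ((2 * (r + s)) ^+ d - (2 * r) ^+ d) + (Fh + tail s) * (2 * r) ^+ d).
Proof.
move=> r0 s0 c0 uA Ar AF.
have rs0 : 0 <= r + s by rewrite addr_ge0 // ltW.
have mC := @measurable_ccube R d (r + s).
have ii : (vol d).-integrable (@ccube R d (r + s))
    (EFin \o (fun y => (Fh + tail s - J) * \1_(@ccube R d r) y)).
  apply: (integrableS measurableT) => //; apply: integrableZ_fin.
  exact: integrable_ccube_indic.
have ci : (vol d).-integrable (@ccube R d (r + s)) (EFin \o (fun=> J)).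
  apply: measurable_bounded_integrable => //; first by rewrite vol_ccube // ltry.
  by exists `|J|; split => // z cz y _; exact: ltW.
(* The majorant is [Fh + tail s] on the inner cube and the crude bound [J] on the layer of width [s]
   around it. *)
pose u y := (Fh + tail s - J) * \1_(@ccube R d r) y + J.
have ui : (vol d).-integrable (@ccube R d (r + s)) (EFin \o u).
  exact: (integrableD mC ii ci).
have uE : \int[vol d]_(y in ccube (r + s)) u y =
    J * ((2 * (r + s)) ^+ d - (2 * r) ^+ d) + (Fh + tail s) * (2 * r) ^+ d.
  rewrite RintegralD // Rintegral_cst // vol_ccube //= RintegralZl //; last first.
    by apply: (integrableS measurableT) => //; exact: integrable_ccube_indic.
  have -> : \int[vol d]_(y in ccube (r + s)) (\1_(@ccube R d r) y : R) = (2 * r) ^+ d.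
    rewrite /Rintegral integral_indic //; last exact: measurable_ccube.
    rewrite setIidl ?vol_ccube // => y yr i; have := yr i.
    by rewrite /= !in_itv /= => /andP[? ?]; apply/andP; split; lra.
  by ring.
have V0 : 0 < (2 * (r + s)) ^+ d by rewrite exprn_gt0 // mulr_gt0 // ltr_wpDl.
have conv_le y : ccube (r + s) y -> conv_on F (ccube (r + s)) y <= u y.
  move=> yC; rewrite /u indicE; case: (asboolP (ccube r y)) => yr.
    rewrite mem_set // mulr1 subrK.
    by have := conv_on_ccube s yr; rewrite ler_norml -/Fh => /andP[_ ?]; lra.
  by rewrite memNset // mulr0 add0r; exact: conv_on_le.
have := quadform_conv_ge0 F_pd F_even F_int mC (vol_ccube d rs0) V0 ui conv_le
  c [seq (1, x) | x <- A].
rewrite uE; move/le_trans; apply; rewrite lerD2r lerB //.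
  exact: quadform_le.
rewrite ler_wpM2l ?mulr_ge0 // big_map -sumr_seq_cst.
rewrite [leLHS]big_seq [leRHS]big_seq; apply: ler_sum => x xA /=; rewrite mul1r.
by have := conv_on_ccube s (Ar x xA); rewrite ler_norml -/Fh => /andP[? _]; lra.
Qed.

End counting.

(** * The limit of large cubes *)

Section asymptotics.
Context {R : realType} {d : nat}.

(** At each point the truncations of |f| to complements of growing cubes are eventually 0, so
    dominated convergence applies. *)
Lemma tail_small (f : 'rV[R]_d -> R) (eps : R) :
  (vol d).-integrable setT (EFin \o f) -> 0 < eps ->
  exists2 s : R, 0 < s & \int[vol d]_(x in ~` ccube s) `|f x| <= eps.
Proof.
move=> fi eps0; have ni := integrable_norm fi.
pose C n := ~` @ccube R d n.+1%:R.
have mC n : measurable (C n) by apply: measurableC; exact: measurable_ccube.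
have cvg0 : (\int[vol d]_(x in C n) `|f x|) @[n --> \oo] --> (0 : R).
  have -> : (fun n => \int[vol d]_(x in C n) `|f x|) =
      fine \o (fun n => (\int[vol d]_x ((EFin \o (Num.Def.normr \o f)) \_ (C n)) x)%E).
    by apply/funext => n; rewrite /= -integral_mkcond.
  apply: fine_cvg.
  rewrite (_ : 0%:E = \int[vol d]_x (cst 0 x : \bar R))%E; last by rewrite integral0.
  apply: (@dominated_cvg _ _ _ _ _ _ _ _ (EFin \o (Num.Def.normr \o f))) => //.
  - move=> n; case/integrableP: ((integrable_mkcond (EFin \o (Num.Def.normr \o f)) (mC n)).1
      (integrableS measurableT (mC n) (@subsetT _ _) ni)) => //.
  - move=> x _; apply: cvg_near_cst.
    pose M : R := \sum_(i < d) `|x 0 i|.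
    exists (Num.truncn M) => // n /= Mn; rewrite patchE memNset //.
    apply => i; rewrite /= in_itv /= -ler_norml.
    apply: (@le_trans _ _ M); first by rewrite /M (bigD1 i) //= lerDl sumr_ge0.
    apply: (le_trans (ltW (truncnS_gt M))); by rewrite ler_nat ltnS.
  - by move=> n x _; rewrite patchE; case: ifP => _; rewrite /= ?normr0 ?normr_id ?lee_fin.
have /cvgrPdist_le/(_ _ eps0)[n _ /(_ n (leqnn n))] := cvg0.
rewrite sub0r normrN => H; exists (n.+1)%:R => //.
exact: le_trans (ler_norm _) H.
Qed.

(** Widening a cube by a constant does not affect its volume asymptotically. *)
Lemma cvg_ratioX (a : R) (n : nat) : ((t + a) / t) ^+ n @[t --> +oo] --> (1 : R).
Proof.
have tV : t^-1 @[t --> +oo] --> (0 : R).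
  apply/(@gtr0_cvgV0 _ _ _ _ id); last exact: cvg_id.
  exact: nbhs_pinfty_gt.
have H : 1 + a * t^-1 @[t --> +oo] --> (1 : R).
  have H := cvgD (cvg_cst (1 : R)) (cvgM (cvg_cst a) tV).
  by rewrite mulr0 addr0 in H; exact: H.
have {}H : (1 + a * t^-1) ^+ n @[t --> +oo] --> (1 : R).
  have Hn := continuous_cvg _ (@exprn_continuous _ n (1 : R)) H.
  by rewrite expr1n in Hn; exact: Hn.
apply: cvg_trans H; apply: near_eq_cvg; near=> t.
have t0 : 0 < t by near: t; exact: nbhs_pinfty_gt.
by rewrite mulrDl divff ?gt_eqF.
Unshelve. all: by end_near. Qed.

Variable F : 'rV[R]_d -> R.
Hypothesis F_pd : forall s, 0 <= quadform F s.
Hypothesis F_even : forall x, F (- x) = F x.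
Hypothesis F_int : (vol d).-integrable setT (EFin \o F).
Hypothesis F0 : 0 < F 0.
Hypothesis Fh0 : 0 < \int[vol d]_x F x.

(** The error terms depend on [t] alone, so one threshold serves all [A]. The side t + 1 leaves room
    for the centers of all balls of radius 1/2 that meet the cube of side [t]. *)
Lemma counting_asymptotic (rho : R) : F 0 / (\int[vol d]_x F x) < rho ->
  \forall t \near +oo, forall A : seq 'rV[R]_d, uniq A ->
    (forall x, x \in A -> ccube ((t + 1) / 2) x) ->
    (forall x y, x \in A -> y \in A -> x != y -> F (x - y) <= 0) ->
    (size A)%:R <= rho * t ^+ d.
Proof.
move: Fh0; set Fh := \int[vol d]_x F x => Fh_gt0 rhoF.
have rho0 : 0 < rho by apply: le_lt_trans rhoF; rewrite divr_ge0 // ltW.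
(* [D] is the available slack. The errors spend three times the tail and once the excess of [w],
   each at most D / 8. *)
pose D := Fh - F 0 / rho.
have D0 : 0 < D by rewrite subr_gt0 ltr_pdivrMr // mulrC -ltr_pdivrMr.
have D8 : 0 < D / 8 by rewrite divr_gt0.
have [s s0 tails] := tail_small F_int D8.
pose J := \int[vol d]_x `|F x|; pose ts := \int[vol d]_(x in ~` ccube s) `|F x|.
have ts0 : 0 <= ts by apply: Rintegral_ge0.
(* The coefficient of c^2 in [counting_bound], divided by t^d; its boundary part tends to 0. *)
pose w t := J * (((t + (1 + 2 * s)) / t) ^+ d - ((t + 1) / t) ^+ d) +
            (Fh + ts) * ((t + 1) / t) ^+ d.
have wcvg : w t @[t --> +oo] --> J * (1 - 1) + (Fh + ts) * 1.
  apply: cvgD; apply: cvgM; [exact: cvg_cst| |exact: cvg_cst|exact: cvg_ratioX].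
  by apply: cvgB; exact: cvg_ratioX.
rewrite subrr mulr0 add0r mulr1 in wcvg.
near=> t => A uA Ar AF.
have t0 : 0 < t by near: t; exact: nbhs_pinfty_gt.
have wt : w t <= Fh + ts + D / 8.
  by near: t; apply: (cvgr_le _ wcvg); rewrite ltrDl.
set N : R := (size A)%:R; have N0 : 0 <= N by [].
have td0 : 0 < t ^+ d by rewrite exprn_gt0.
pose c := N / t ^+ d; have c0 : 0 <= c by rewrite divr_ge0 // ltW.
have r0 : 0 <= (t + 1) / 2 by rewrite divr_ge0 // addr_ge0 // ltW.
have := counting_bound F_pd F_even F_int r0 s0 c0 uA Ar AF.
rewrite -/N -/J -/ts -/Fh.
have -> : 2 * ((t + 1) / 2 + s) = t + (1 + 2 * s) by field.
have -> : 2 * ((t + 1) / 2) = t + 1 by field.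
have -> : J * ((t + (1 + 2 * s)) ^+ d - (t + 1) ^+ d) + (Fh + ts) * (t + 1) ^+ d =
    t ^+ d * w t.
  rewrite /w !expr_div_n; move: td0 => /lt0r_neq0; move: (t ^+ d) => z z0.
  by field.
have NE : N = c * t ^+ d by rewrite /c divfK // gt_eqF.
rewrite NE; move=> H.
have {H} : 0 <= c * t ^+ d * (F 0 - c * (2 * (Fh - ts) - w t)).
  by apply: le_trans H _; rewrite le_eqVlt; apply/orP; left; apply/eqP; ring.
have [c00|cpos] := leP c 0.
  move=> _; rewrite ler_pM2r //; apply: (le_trans c00); exact: ltW.
have ct0 : 0 < c * t ^+ d by exact: mulr_gt0.
rewrite (pmulr_rge0 _ ct0) subr_ge0 => H.
rewrite ler_pM2r //.
suff : c * (F 0 / rho) <= F 0 by rewrite mulrCA ger_pMr // ler_pdivrMr // mul1r.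
apply: le_trans H; rewrite ler_pM2l //.
by move: wt tails; rewrite -/ts /D; lra.
Unshelve. all: by end_near. Qed.

End asymptotics.

(** * Packing density *)

Section packing_density.
Context {R : realType} {d : nat}.
Implicit Types (x y : 'rV[R]_d) (X : set 'rV[R]_d).

Lemma coord_sqr_le_dot x i : x 0 i ^+ 2 <= dot x x.
Proof.
rewrite /dot (bigD1 i) //= -expr2 lerDl.
by apply: sumr_ge0 => j _; rewrite -expr2 sqr_ge0.
Qed.

Lemma enorm_eq0 x : enorm x = 0 -> x = 0.
Proof.
move=> /eqP; rewrite sqrtr_eq0 => x0; apply/rowP => i; rewrite mxE.
apply/eqP; rewrite -sqrf_eq0 eq_le sqr_ge0 andbT.
exact: le_trans (coord_sqr_le_dot x i) x0.
Qed.

(** The ball of radius 1/2, written without the square root to suit polynomial arithmetic. *)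
Definition half_ball : set 'rV[R]_d := [set y | dot y y <= 4^-1].

Lemma half_ballE : dilate 2^-1 (@unit_ball R d) = half_ball.
Proof.
apply/seteqP; split => [_ [x x1 <-]|y y1].
  have : dot x x <= 1.
    by move: x1; rewrite /unit_ball /= /enorm -[leRHS]sqrtr1 ler_sqrt.
  rewrite /half_ball /= dotZr.
  have -> : dot (2^-1 *: x) x = 2^-1 * dot x x.
    by rewrite /dot mulr_sumr; apply: eq_bigr => i _; rewrite !mxE mulrA.
  lra.
exists (2 *: y); last by rewrite scalerA mulVf ?scale1r.
rewrite /unit_ball /= /enorm -[leRHS]sqrtr1 ler_sqrt // dotZr.
have -> : dot (2 *: y) y = 2 * dot y y.
  by rewrite /dot mulr_sumr; apply: eq_bigr => i _; rewrite !mxE mulrA.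
by move: y1; rewrite /half_ball /=; lra.
Qed.

Lemma measurable_half_ball : measurable half_ball.
Proof.
have mdot : measurable_fun setT (fun y : 'rV[R]_d => dot y y).
  apply: measurable_sum => i; apply: measurable_funM; exact: measurable_coord.
rewrite (_ : half_ball = setT `&` (fun y => dot y y) @^-1` `]-oo, 4^-1]%classic).
  exact: mdot.
by apply/seteqP; split => y; rewrite /half_ball /= in_itv //= => -[].
Qed.

Lemma half_ball_sub : half_ball `<=` ccube 2^-1.
Proof.
move=> y yb i; have := le_trans (coord_sqr_le_dot y i) yb.
by rewrite /= in_itv /= => ?; apply/andP; split; nra.
Qed.

Lemma vol_half_ball : exists2 v : R, 0 < v & vol d half_ball = v%:E.
Proof.
have vle : (vol d half_ball <= 1%:E)%E.
  apply: (@le_trans _ _ (vol d (ccube 2^-1))).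
    apply: le_measure; rewrite ?inE; [exact: measurable_half_ball|exact: measurable_ccube|].
    exact: half_ball_sub.
  by rewrite vol_ccube // divff // expr1n.
(* This half-side gives d r^2 <= 1/4, so the cube lies in the ball. *)
pose r : R := (2 * d.+1%:R)^-1.
have r0 : 0 < r by rewrite invr_gt0 mulr_gt0.
have rsub : ccube r `<=` half_ball.
  move=> y /dot_ccube yr; apply: (le_trans yr).
  have d0 : 0 <= d%:R :> R by [].
  have : r * (2 * (1 + d%:R)) = 1 by rewrite /r nat1r mulVf // mulf_neq0 // pnatr_eq0.
  by move: (d%:R : R) d0 => z z0; nra.
have vge : (((2 * r) ^+ d)%:E <= vol d half_ball)%E.
  rewrite -(vol_ccube d (ltW r0)).
  by apply: le_measure; rewrite ?inE; [exact: measurable_ccube|exact: measurable_half_ball|].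
have vfin : vol d half_ball \is a fin_num.
  by rewrite ge0_fin_numE // (le_lt_trans vle) // ltry.
exists (fine (vol d half_ball)); last by rewrite fineK.
rewrite -lte_fin fineK //; apply: lt_le_trans vge.
by rewrite lte_fin exprn_gt0 // mulr_gt0.
Qed.

Lemma dilate_cube (t : R) : 0 < t -> dilate t (@cube R d) = ccube (t / 2).
Proof.
move=> t0; apply/seteqP; split => [_ [x xc <-] i|y yc].
  have := xc i; rewrite /= in_itv /= mxE => /andP[? ?]; apply/andP; split; nra.
exists (t^-1 *: y); last by rewrite scalerA divff ?scale1r ?gt_eqF.
move=> i; have := yc i; rewrite /= in_itv /= mxE.
by rewrite ler_pdivlMl // ler_pdivrMl // mulrN.
Qed.

Definition ball_at x : set 'rV[R]_d := [set p | half_ball (p - x)].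

Lemma ball_atE x : ball_at x = affine 1 (- x) @^-1` half_ball.
Proof. by apply/seteqP; split => p; rewrite /ball_at /affine /= scale1r. Qed.

Lemma measurable_ball_at x : measurable (ball_at x).
Proof.
rewrite ball_atE -[X in measurable X]setTI; apply: measurable_affine => //.
exact: measurable_half_ball.
Qed.

Lemma vol_ball_at x : vol d (ball_at x) = vol d half_ball.
Proof.
rewrite ball_atE; apply: vol_affine; [by left | exact: measurable_half_ball].
Qed.

(** A ball meeting the cube of side [t] has its center in the cube of side t + 1, so finitely many
    balls cover the intersection, and subadditivity applies. *)
Lemma vol_balls_le (v t : R) X (s : seq 'rV[R]_d) : 0 <= t -> vol d half_ball = v%:E ->
  (forall x, X x -> ccube ((t + 1) / 2) x -> x \in s) ->
  (forall x, x \in s -> X x) ->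
  (vol d (balls X `&` ccube (t / 2)) <= ((size s)%:R * v)%:E)%E.
Proof.
move=> t0 volv Xs sX.
pose U (s : seq 'rV[R]_d) := \big[setU/set0]_(x <- s) ball_at x.
have mU s' : measurable (U s') by apply: bigsetU_measurable => x _; exact: measurable_ball_at.
have -> : balls X `&` ccube (t / 2) = U s `&` ccube (t / 2).
  apply/seteqP; split => p [pX pc]; split => //; last first.
    move: pX; rewrite /U -bigcup_seq => -[x xs xp].
    exists x; first exact: sX.
    by exists (p - x); [rewrite half_ballE | rewrite addrCA subrr addr0].
  move: pX => [x Xx [y]]; rewrite half_ballE => yb xyp.
  rewrite /U -bigcup_seq; exists x; last by rewrite /ball_at /= -xyp addrAC subrr add0r.
  apply: Xs => // i; have := pc i; have := half_ball_sub yb i.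
  rewrite -xyp /= !in_itv /= mxE => /andP[? ?] /andP[? ?]; apply/andP; split; lra.
apply: (@le_trans _ _ (vol d (U s))).
  apply: le_measure; [rewrite inE|by rewrite inE|exact: subIsetl].
  by apply: measurableI => //; exact: measurable_ccube.
elim: {Xs sX} s => [|x s IH]; first by rewrite /U big_nil measure0 mul0r.
rewrite /U big_cons -/(U s).
have U2 : (vol d (ball_at x `|` U s) <= vol d (ball_at x) + vol d (U s))%E.
  by apply: measureU2 => //; exact: measurable_ball_at.
apply: (le_trans U2); rewrite vol_ball_at volv -nat1r mulrDl mul1r EFinD.
exact: leeD2l.
Qed.

(* A packing is locally finite because every finite part of it obeys the
   counting bound. *)
Lemma density_le (v rho : R) X : 0 < v -> vol d half_ball = v%:E ->
  (\forall t \near +oo, forall A : seq 'rV[R]_d, uniq A ->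
     (forall x, x \in A -> X x /\ ccube ((t + 1) / 2) x) -> (size A)%:R <= rho * t ^+ d) ->
  (density (balls X) <= (v * rho)%:E)%E.
Proof.
move=> v0 volv H; rewrite /density /limf_esup; apply: ge_ereal_inf => /=.
pose f t := (vol d (balls X `&` dilate t (@cube R d)) / vol d (dilate t (@cube R d)))%E.
suff H' : \forall t \near +oo, (f t <= (v * rho)%:E)%E.
  (* The upper limit is an infimum of suprema over sets of the filter; the set where the bound holds
     is one of them. *)
  exists (ereal_sup (f @` [set t | (f t <= (v * rho)%:E)%E])).
    by eexists; first exact: H'.
  by apply: ge_ereal_sup => _ [t ft <-].
near=> t.
have t0 : 0 < t by near: t; exact: nbhs_pinfty_gt.
have Ht : forall A : seq 'rV[R]_d, uniq A ->
    (forall x, x \in A -> X x /\ ccube ((t + 1) / 2) x) -> (size A)%:R <= rho * t ^+ d.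
  by near: t.
have fin : finite_set (X `&` ccube ((t + 1) / 2)).
  have [//|inf] := pselect (finite_set (X `&` ccube ((t + 1) / 2))); exfalso.
  have [B BX] := infinite_set_fset (Num.truncn (rho * t ^+ d)).+1 inf.
  have Bs := Ht (finmap.enum_fset B) (finmap.fset_uniq B) (fun x xB => BX x xB).
  have := truncnS_gt (rho * t ^+ d) => /(le_lt_trans Bs); rewrite ltr_nat => + h.
  by rewrite ltnNge h.
have [s sE] := (finite_seqP _).1 fin.
have uE x : x \in undup s <-> X x /\ ccube ((t + 1) / 2) x.
  rewrite mem_undup; have -> : (x \in s) = [set` s] x :> Prop by [].
  by rewrite -sE.
have t20 : 0 <= t / 2 by rewrite divr_ge0 // ltW.
rewrite /f dilate_cube // (vol_ccube d t20).
have -> : 2 * (t / 2) = t by field.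
rewrite inver gt_eqF ?exprn_gt0 // lee_pdivrMr ?exprn_gt0 //.
apply: (le_trans (@vol_balls_le v t X (undup s) (ltW t0) volv _ _)).
- by move=> x Xx xc; apply/uE.
- by move=> x /uE[].
rewrite -EFinM lee_fin mulrC -mulrA ler_wpM2l ?(ltW v0) //.
apply: Ht; first exact: undup_uniq.
by move=> x /uE.
Unshelve. all: by end_near. Qed.

End packing_density.

(** * Feasible functions and the linear programming bound *)

Section feasible.
Context {R : realType} {d : nat}.
Implicit Types (F : 'rV[R]_d -> R) (xi : 'rV[R]_d).

Lemma fourierE F xi : fourier F xi = Complex
  (\int[vol d]_x (F x * cos (dot x ((2 * pi) *: xi))))
  (\int[vol d]_x (F x * - sin (dot x ((2 * pi) *: xi)))).
Proof.
rewrite /fourier /cintegral; congr Complex; apply: eq_Rintegral => x _;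
  by rewrite /= dotZr ?cosN ?sinN mul0r ?subr0 ?addr0.
Qed.

Lemma Re_fourier0 F : complex.Re (fourier F 0) = \int[vol d]_x F x.
Proof.
rewrite fourierE /=; apply: eq_Rintegral => x _.
by rewrite scaler0 -(scale0r 0) dotZr mul0r cos0 mulr1.
Qed.

(** Nonnegativity in [R[i]] contains both claims, a zero imaginary part and a nonnegative real part;
    evaluation at xi / (2 pi) removes the scaling. *)
Lemma LP_feasible_cospos (K : set R) F : LP_feasible K F ->
  cospos F /\ forall xi, \int[vol d]_x (F x * sin (dot x xi)) = 0.
Proof.
move=> [_ Fi _ _ Fpos].
have pi20 : 2 * pi != 0 :> R by rewrite mulf_neq0 // gt_eqF // pi_gt0.
have H xi : \int[vol d]_x (F x * - sin (dot x xi)) = 0 /\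
            0 <= \int[vol d]_x (F x * cos (dot x xi)).
  have := Fpos ((2 * pi)^-1 *: xi); rewrite fourierE scalerA divff // scale1r.
  by rewrite lecE /= => /andP[/eqP].
split; first by split => // xi; exact: (H xi).2.
move=> xi; have := (H xi).1; under eq_Rintegral do rewrite mulrN -mulN1r.
rewrite RintegralZl //; last exact: integrable_sin.
by move/eqP; rewrite mulN1r oppr_eq0 => /eqP.
Qed.

End feasible.

Theorem theorem2p1 (R : realType) (d : nat) (K : set R)
    (d_ge1 : (1 <= d)%N)
    (K_ge1 : K `<=` `[1, +oo[)
    (K_bounded : bounded_set K)
    (K1 : K 1) :
  (max_density d K <= LP_bound d K)%E.
Proof.
have [v v0 volv] := @vol_half_ball R d.
rewrite /LP_bound half_ballE volv -lee_pdivrMl //.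
apply: le_ereal_inf_tmp => _ [F FK <-]; rewrite lee_pdivrMl //.
have [F0 Fs] := LP_feasible_cospos FK; have [Fex Fi cF FleK Fpos] := FK.
have Fpd s : 0 <= quadform F s by exact: cospos_quadform.
have Fev := cospos_even F0 cF Fs; have F00 := cospos_gt0 F0 cF Fs Fex.
rewrite /LP_ratio Re_fourier0; set Fh := \int[vol d]_x F x.
have Fh_ge0 : 0 <= Fh by rewrite /Fh -Re_fourier0; have := Fpos 0; rewrite lecE => /andP[].
(* For a zero integral the ratio is +oo, because F(0) > 0, and the bound is trivial. *)
have [Fh0|Fh_gt0] := eqVneq Fh 0.
  by rewrite Fh0 inve0 gt0_muley ?lte_fin // gt0_muley ?lte_fin // leey.
rewrite inver (negbTE Fh_gt0) -!EFinM.
have {}Fh_gt0 : 0 < Fh by rewrite lt0r Fh_gt0.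
apply: ge_ereal_sup => _ [_ [X [Xpack Xadm] <-] <-].
apply/lee_addgt0Pr => e e0.
(* The counting bound asks for a strict inequality; the surplus e / v costs exactly [e] after
   multiplication by [v]. *)
pose rho := F 0 / Fh + e / v.
have -> : ((v * (F 0 / Fh))%:E + e%:E)%E = (v * rho)%:E.
  by rewrite -EFinD /rho mulrDr [v * (e / v)]mulrC divfK // gt_eqF.
have rhoF : F 0 / Fh < rho by rewrite ltrDl divr_gt0.
apply: density_le => //.
have := counting_asymptotic Fpd Fev Fi F00 Fh_gt0 rhoF.
apply: filterS => t H A uA AX; apply: H => //; first by move=> x /AX[].
move=> x y xA yA xy; apply: FleK.
(* Distinct centers exclude distance 0; the other two cases are those where feasibility makes [F]
   nonpositive. *)
have := Xadm x y (AX x xA).1 (AX y yA).1; case; last by right.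
case; last by left.
by move/enorm_eq0/eqP; rewrite subr_eq0 (negbTE xy).
Qed.
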